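(* Let $l/\mathbb{Q}$ be a finite Galois extension with group $G$, $\widehat w$ an archimedean place of $l$, $\Psi=\{\psi_1,\dots,\psi_N\}$ a transversal for the left cosets of $G_{\widehat w}$, and $\Delta$ as in the context. If $\beta\in F_l$ is a special Minkowski unit with respect to $\widehat w$, then $\{\Delta(\beta,f):f\in\mathbb{Z}^N\}$ is a subgroup of $F_l$ of rank $N-1$; equivalently the kernel $\{f\in\mathbb{Z}^N:\Delta(\beta,f)=1\}$ has rank $1$.
   Context: $F_l=O_l^\times/\mathrm{Tor}(O_l^\times)$, with $G=\mathrm{Aut}(l/\mathbb{Q})$ acting on it. For a place $w$ of $l$, $\|\cdot\|_w$ extends the usual absolute value of $\mathbb{Q}$ and $|\cdot|_w=\|\cdot\|_w^{d_w/d}$, $d_w=[l_w:\mathbb{Q}_w]$, $d=[l:\mathbb{Q}]$. For $\sigma\in G$, $\sigma w$ is the place with $\|\sigma^{-1}(\gamma)\|_w=\|\gamma\|_{\sigma w}$; $G_{\widehat w}=\{\sigma\in G:\sigma\widehat w=\widehat w\}$, and $N=[G:G_{\widehat w}]$ is the number of archimedean places. $\mathbb{Z}^N$ is the group of functions $f:G\to\mathbb{Z}$ constant on left cosets of $G_{\widehat w}$, and $\Delta(\alpha,f)=\prod_{n=1}^N\psi_n(\alpha)^{f(\psi_n)}$. An element $\beta\in F_l$ is a special Minkowski unit with respect to $\widehat w$ if $\log|\beta|_w<0$ for every archimedean place $w\ne\widehat w$. *)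

(* Defs.v *)
From HB Require Import structures.
From mathcomp Require Import all_boot all_order all_algebra all_fingroup all_field.
Set Implicit Arguments. Unset Strict Implicit. Unset Printing Implicit Defensive.
Import Order.TTheory GRing.Theory Num.Theory.
Local Open Scope ring_scope.

(* l : a finite Galois extension of Q, modelled as L : splittingFieldType rat
   (finite normal extension of Q; separable since char 0).  G = Aut(l/Q) is
   gal_of {:L}.  Archimedean places are given by embeddings L -> algC
   (all complex embeddings of a number field land in the algebraic numbers),
   the place of an embedding tau being the absolute value x |-> `|tau x|. *)

Definition OL_unit (L : fieldExtType rat) (b : L) : Prop :=
  integralOver (fun z : int => z%:~R : L) b /\ b != 0 /\
  integralOver (fun z : int => z%:~R : L) b^-1.

(* membership in Tor(O_l^x), i.e. the element is 1 in F_l *)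
Definition is_torsion (L : fieldExtType rat) (x : L) : Prop :=
  exists k : nat, (0 < k)%N /\ x ^+ k = 1.

(* ||gamma||_{sigma w^}, where w^ is the place of the embedding iota:
   ||gamma||_{sigma w^} = ||sigma^-1 gamma||_{w^}. *)
Definition gal_place (L : splittingFieldType rat) (iota : {rmorphism L -> algC})
  (s : gal_of {:L}) : L -> algC :=
  fun g => `|iota ((s^-1)%g g)|.

Definition same_place (L : splittingFieldType rat) (iota : {rmorphism L -> algC})
  (s t : gal_of {:L}) : Prop :=
  forall g : L, gal_place iota s g = gal_place iota t g.

(* Z^N : functions G -> Z constant on the left cosets sigma G_{w^}
   (= the fibres of sigma |-> sigma w^). *)
Definition ZN (L : splittingFieldType rat) (iota : {rmorphism L -> algC})
  (f : {ffun gal_of {:L} -> int}) : Prop :=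
  forall s t : gal_of {:L}, same_place iota s t -> f s = f t.

Definition gal_transversal (L : splittingFieldType rat) (iota : {rmorphism L -> algC})
  (N : nat) (psi : 'I_N -> gal_of {:L}) : Prop :=
  (forall s : gal_of {:L}, exists n : 'I_N, same_place iota s (psi n)) /\
  (forall m n : 'I_N, same_place iota (psi m) (psi n) -> m = n).

Definition Delta (L : splittingFieldType rat) (N : nat) (psi : 'I_N -> gal_of {:L})
  (b : L) (f : {ffun gal_of {:L} -> int}) : L :=
  \prod_(n < N) (psi n b) ^ (f (psi n)).

(* beta (a representative in O_l^x of a class in F_l) is a special Minkowski
   unit w.r.t. the place w^ of iota: log|beta|_w < 0, i.e. `|tau beta| < 1,
   for every archimedean place w (given by an embedding tau) different from w^. *)
Definition special_Minkowski (L : splittingFieldType rat) (iota : {rmorphism L -> algC})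
  (b : L) : Prop :=
  OL_unit b /\
  forall tau : {rmorphism L -> algC},
    (fun g : L => `|tau g|) <> (fun g : L => `|iota g|) -> `|tau b| < 1.

Definition Z_indep (V : zmodType) (r : nat) (v : 'I_r -> V) : Prop :=
  forall c : 'I_r -> int, \sum_(i < r) v i *~ c i = 0 -> forall i, c i = 0.

Definition has_Zrank (V : zmodType) (P : V -> Prop) (r : nat) : Prop :=
  (exists v : 'I_r -> V, (forall i, P (v i)) /\ Z_indep v) /\
  (forall v : 'I_r.+1 -> V, (forall i, P (v i)) -> ~ Z_indep v).

(* Main.v *)
Require Import Defs.
From HB Require Import structures.
From mathcomp Require Import all_boot all_order all_algebra all_fingroup all_field.
Import Order.TTheory GRing.Theory Num.Theory.
Local Open Scope ring_scope.

(** Let [a m n] be the absolute value of [psi n b] at the place of [psi m].  All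
    entries with [m <> n] are [< 1], and every column has product [1] by the
    product formula (all local degrees agree, so no exponent is needed).  The
    logarithms thus form a matrix with negative off-diagonal entries and zero
    column sums, which forces any two multiplicative relations between its
    columns to be proportional.

    A relation exists for the following reason.  Starting from [1], multiply
    repeatedly by some [psi n b] at whose place the current product is at most
    [1]; all products [x_k] obtained are bounded by one constant [A] at every
    place.  Choose an integer [M > 2 A].  By pigeonhole two products [x_i], [x_j]
    with [i < j] are congruent modulo [M], so [(x_i - x_j) / M] is an algebraic
    integer all of whose conjugates are smaller than [1]; hence [x_i = x_j]. *)

(** * Matrices with small off-diagonal entries and column products 1 *)

Section PlaceMatrix.

Variables (R : numFieldType) (I : finType) (a : I -> I -> R).
Hypothesis a_gt0 : forall m n, 0 < a m n.
Hypothesis a_lt1 : forall m n, m != n -> a m n < 1.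
Hypothesis a_col1 : forall n, \prod_m a m n = 1.

Lemma exprz_gt1 (x : R) (k : int) : 1 < x -> 0 < k -> 1 < x ^ k.
Proof. by case: k => // -[|k] // x1 _; rewrite exprn_egt1. Qed.

Lemma exprz_ile1_ge1 (x : R) (k : int) :
  0 < x -> x <= 1 -> k <= 0 -> 1 <= x ^ k.
Proof.
case: k => [[|k] //|k] x0 x1 _.
by rewrite /exprz invf_ge1 ?exprn_gt0 // exprn_ile1 // ltW.
Qed.

(* Multiplying the relations of the rows [m] with [f m > 0], every column
   contributes a factor at least [1], and more than [1] if [f n > 0]. *)
Lemma relation_le0 (f : I -> int) (n0 : I) :
  (forall m, \prod_n a m n ^ f n = 1) -> f n0 = 0 -> forall n, f n <= 0.
Proof.
move=> rel fn0 n1; rewrite leNgt; apply/negP => fn1.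
pose S n := \prod_(m | 0 < f m) a m n.
have S_gt0 n : 0 < S n by apply: prodr_gt0.
have prodS : \prod_n S n ^ f n = 1.
  have -> : \prod_n S n ^ f n = \prod_n \prod_(m | 0 < f m) a m n ^ f n.
    apply: eq_bigr => n _; rewrite /S.
    exact: (big_morph (fun x => x ^ f n) (fun x y => expfzMl x y _) (exp1rz _ _)).
  by rewrite exchange_big big1.
have S_gt1 n : 0 < f n -> 1 < S n.
  move=> fn; have := a_col1 n; rewrite (bigID (fun m => 0 < f m)) /= -/(S n).
  set T := \prod_(_ | _) _ => ST.
  have T0 : 0 < T by apply: prodr_gt0.
  have n0n : n0 != n by apply: contraTneq fn => <-; rewrite fn0.
  (* [0 < f n] makes every factor of [T] off-diagonal, and [f n0 = 0] ensures that [T] is not an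
     empty product. *)
  have T1 : T < 1.
    rewrite /T (bigD1 n0) ?fn0 //=.
    apply: le_lt_trans (a_lt1 _ _ n0n); rewrite ler_piMr ?(ltW (a_gt0 _ _)) //.
    apply: prodr_ile1 => m /andP[/negP fm _]; rewrite ltW //= ltW // a_lt1 //.
    by apply: contra_notN fm => /eqP->.
  by rewrite -ST gtr_pMr.
have S_le1 n : ~~ (0 < f n) -> S n <= 1.
  move=> fn; apply: prodr_ile1 => m fm; rewrite ltW //= ltW // a_lt1 //.
  by apply: contraNneq fn => <-.
suff : 1 < \prod_n S n ^ f n by rewrite prodS ltxx.
rewrite (bigD1 n1) //=.
apply: lt_le_trans (exprz_gt1 _ _ (S_gt1 _ fn1) fn1) _.
rewrite ler_peMr ?exprz_ge0 ?(ltW (S_gt0 _)) //.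
apply: (big_ind (fun x => 1 <= x)) => // [x y|n _]; first exact: mulr_ege1.
have [fn|fn] := boolP (0 < f n); first by rewrite ltW // exprz_gt1 // S_gt1.
by rewrite exprz_ile1_ge1 ?S_le1 // leNgt.
Qed.

(** Relations are closed under negation, so the sign bound applies to both [f] and [- f]. *)
Lemma relation_eq0 (f : I -> int) (n0 : I) :
  (forall m, \prod_n a m n ^ f n = 1) -> f n0 = 0 -> forall n, f n = 0.
Proof.
move=> rel fn0 n; apply/eqP; rewrite eq_le (relation_le0 f n0) //=.
rewrite -oppr_le0 (relation_le0 (fun n => - f n) n0) ?fn0 // => m.
under eq_bigr => i _ do rewrite -invr_expz.
by rewrite prodfV rel invr1.
Qed.

(** [w] will encode the unit [\prod_n psi n b ^+ w n]; the walk runs on exponents, so that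
    [sum_walk] can tell its steps apart. *)
Definition place_value (w : {ffun I -> nat}) m := \prod_n a m n ^+ w n.

Definition walk_step (w : {ffun I -> nat}) : {ffun I -> nat} :=
  if [pick n | place_value w n <= 1] is Some n0
  then [ffun n => (w n + (n == n0))%N] else w.

Definition walk k := iter k walk_step [ffun=> 0%N].

Lemma prod_place_value w : \prod_m place_value w m = 1.
Proof.
rewrite exchange_big big1 //= => n _.
by rewrite prodrXl a_col1 expr1n.
Qed.

Lemma place_value_gt0 w m : 0 < place_value w m.
Proof. by apply: prodr_gt0 => n _; rewrite exprn_gt0. Qed.

(** Values all above 1 could not have product 1; [i0] rules out the empty product. *)
Lemma exists_small_place (i0 : I) w : exists n, place_value w n <= 1.
Proof.
have [/existsP//|] := boolP [exists n, place_value w n <= 1].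
rewrite negb_exists => /forallP small.
have gt1 n : 1 < place_value w n.
  by rewrite real_ltNge ?small ?real1 // gtr0_real // place_value_gt0.
suff : 1 < \prod_m place_value w m by rewrite prod_place_value ltxx.
rewrite (bigD1 i0) //=; apply: lt_le_trans (gt1 i0) _.
rewrite ler_peMr ?(ltW (place_value_gt0 _ _)) //.
apply: (big_ind (fun x => 1 <= x)) => // [x y|n _]; first exact: mulr_ege1.
exact/ltW/gt1.
Qed.

Lemma walk_stepP (i0 : I) w : exists2 n0, place_value w n0 <= 1 &
  walk_step w = [ffun n => (w n + (n == n0))%N].
Proof.
rewrite /walk_step; case: pickP => [n small|none]; first by exists n.
by have [n] := exists_small_place i0 w; rewrite none.
Qed.

(** Consequently the walk never revisits an exponent vector, which makes the relation found by
    pigeonhole nontrivial. *)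
Lemma sum_walk (i0 : I) k : (\sum_n walk k n = k)%N.
Proof.
elim: k => [|k IHk]; first by rewrite big1 // => n _; rewrite ffunE.
have [n0 _ /= ->] := walk_stepP i0 (walk k).
under eq_bigr => n _ do rewrite ffunE.
by rewrite big_split /= IHk (bigD1 n0) //= eqxx big1 ?addn1 // => n /negPf->.
Qed.

(* Only the value at the chosen place, which is at most [1], can grow. *)
Lemma walk_bounded (i0 : I) (A : R) : 1 <= A -> (forall n, a n n <= A) ->
  forall k m, place_value (walk k) m <= A.
Proof.
move=> A1 aA; elim=> [|k IHk] m.
  by rewrite /place_value big1 // => n _; rewrite ffunE.
have [n0 small /= ->] := walk_stepP i0 (walk k).
have -> : place_value [ffun n => (walk k n + (n == n0))%N] m =
          place_value (walk k) m * a m n0.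
  rewrite /place_value; under eq_bigr => n _ do rewrite ffunE exprD.
  rewrite big_split /= [X in _ * X = _](bigD1 n0) //= eqxx expr1.
  by rewrite [X in _ * (_ * X)]big1 ?mulr1 // => n /negPf->.
have [->|mn0] := eqVneq m n0.
  rewrite -[A]mul1r ler_pM ?aA // ltW // ?a_gt0 ?place_value_gt0 //.
rewrite -[A]mulr1 ler_pM ?IHk // ltW // ?a_lt1 ?place_value_gt0 //.
Qed.

End PlaceMatrix.

Lemma dup_of_nat_seq (C : finType) (F : nat -> C) :
  exists i j, (i < j)%N /\ F i = F j.
Proof.
have /injectivePn[x [y xy Fxy]] : ~~ injectiveb (fun i : 'I_#|C|.+1 => F i).
  by apply/injectiveP => /leq_card; rewrite card_ord ltnn.
by have [lt|lt|/val_inj eq] := ltngtP x y; [exists x, y|exists y, x|rewrite eq eqxx in xy].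
Qed.

(** * Congruences between algebraic integers *)

Section IntegralCongruence.

Variable K : fieldType.
Notation ZK := (intr : int -> K).

Lemma integral_prod (I : Type) (r : seq I) (P : pred I) (F : I -> K) :
  (forall i, P i -> integralOver ZK (F i)) ->
  integralOver ZK (\prod_(i <- r | P i) F i).
Proof.
move=> intF; apply: (big_ind (integralOver ZK)) => //; first exact: integral1.
by move=> x y; apply: integral_mul.
Qed.

Lemma integral_sum (I : Type) (r : seq I) (P : pred I) (F : I -> K) :
  (forall i, P i -> integralOver ZK (F i)) ->
  integralOver ZK (\sum_(i <- r | P i) F i).
Proof.
move=> intF; apply: (big_ind (integralOver ZK)) => //; first exact: integral0.
by move=> x y; apply: integral_add.
Qed.

Lemma integral_exp (x : K) k : integralOver ZK x -> integralOver ZK (x ^+ k).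
Proof.
move=> intx; rewrite -(card_ord k) -prodr_const; exact: integral_prod.
Qed.

Definition int_cong (M : nat) (x y : K) :=
  exists2 z, integralOver ZK z & x - y = M%:R * z.

Lemma int_cong_prod M (I : Type) (r : seq I) (F G : I -> K) :
  (forall i, integralOver ZK (F i)) -> (forall i, integralOver ZK (G i)) ->
  (forall i, int_cong M (F i) (G i)) ->
  int_cong M (\prod_(i <- r) F i) (\prod_(i <- r) G i).
Proof.
move=> intF intG FG; elim: r => [|i r [z intz zE]].
  by exists 0; rewrite ?big_nil ?subrr ?mulr0 //; apply: integral0.
have [t intt tE] := FG i.
(* With [P], [Q] the products over the tail, [F P - G Q = F (P - Q) + (F - G) Q]. *)
exists (F i * z + t * \prod_(j <- r) G j).
  apply: integral_add; apply: integral_mul => //; exact: integral_prod.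
rewrite !big_cons mulrDr mulrCA -zE mulrA -tE mulrBr mulrBl.
by rewrite addrA subrK.
Qed.

(* The colour of [k] lists the residues of the coefficients of the remainder of
   [X^k] modulo an integral equation of [x]. *)
Lemma int_cong_power_color (x : K) (M : nat) : integralOver ZK x -> (0 < M)%N ->
  exists (C : finType) (col : nat -> C), forall i j, col i = col j ->
    forall (s : {rmorphism K -> K}), int_cong M (s x ^+ i) (s x ^+ j).
Proof.
move=> [p mon_p px0] M0; pose d := size p.
pose q k := Pdiv.CommonRing.rmodp 'X^k p.
have M0z : (M%:Z != 0) by rewrite -lt0n.
have modM (c : int) : (absz (c %% M)%Z < M)%N.
  by rewrite -ltz_nat gez0_abs ?modz_ge0 // ltz_pmod.
pose col k : {ffun 'I_d -> 'I_M} := [ffun i => Ordinal (modM (q k)`_(nat_of_ord i))].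
exists {ffun 'I_d -> 'I_M}, col => i j eq_col s.
have sz k : (size (q k) <= d)%N.
  by rewrite ltnW // Pdiv.CommonRing.ltn_rmodpN0 ?monic_neq0.
(* Since [p] has integer coefficients, [s x] is a root too, and one colouring serves every [s]. *)
have sx : root (map_poly ZK p) (s x).
  have -> : map_poly ZK p = map_poly s (map_poly ZK p).
    by rewrite -map_poly_comp; apply: eq_map_poly => c /=; rewrite rmorph_int.
  by rewrite /root horner_map (eqP px0) rmorph0.
have intsx : integralOver ZK (s x) by exists p.
have powE k : s x ^+ k = \sum_(l < d) ((q k)`_l)%:~R * s x ^+ l.
  have /(congr1 (fun r => (map_poly ZK r).[s x])) := Pdiv.RingMonic.rdivp_eq mon_p 'X^k.
  rewrite -/(q k) rmorphD rmorphM /= map_polyXn hornerD hornerM hornerXn.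
  rewrite (eqP sx) mulr0 add0r => ->.
  rewrite (@horner_coef_wide _ d) ?size_map_poly_leq //.
    by apply: eq_bigr => l _; rewrite coef_map.
  exact: leq_trans (size_poly _ _) (sz k).
(* The residues agree, so only the quotients by [M] remain in the difference. *)
exists (\sum_(l < d) (((q i)`_l %/ M)%Z - ((q j)`_l %/ M)%Z)%:~R * s x ^+ l).
  apply: integral_sum => l _; apply: integral_mul; last exact: integral_exp.
  exact: (integral_id ZK).
rewrite !powE -sumrB mulr_sumr; apply: eq_bigr => l _.
rewrite -mulrBl mulrA; congr (_ * _); rewrite -rmorphB /=.
have eqm : ((q i)`_l %% M)%Z = ((q j)`_l %% M)%Z.
  have /ffunP/(_ l) := eq_col; rewrite !ffunE => /(congr1 val) /= eqa.
  by rewrite -[LHS]gez0_abs ?modz_ge0 // eqa gez0_abs ?modz_ge0.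
rewrite {1}(divz_eq (q i)`_l M) {1}(divz_eq (q j)`_l M) eqm.
rewrite [X in X%:~R](_ : _ = M%:Z * (((q i)`_l %/ M)%Z - ((q j)`_l %/ M)%Z)).
  by rewrite rmorphM.
by rewrite mulrBr ![M%:Z * _]mulrC opprD addrACA subrr addr0.
Qed.

End IntegralCongruence.

(** * Norms and Galois conjugate places *)

Section GaloisPlaces.

Variables (L : splittingFieldType rat) (iota : {rmorphism L -> algC}).
Notation G := (gal_of {:L}).
Notation ZL := (intr : int -> L).

Lemma integral_Aint (x : L) : integralOver ZL x -> iota x \in Aint.
Proof.
case=> p mon_p px0; apply: (@root_monic_Aint (map_poly intr p)).
- rewrite (_ : map_poly intr p = map_poly iota (map_poly ZL p)).
    by rewrite fmorph_root.
  by rewrite -map_poly_comp; apply: eq_map_poly => c /=; rewrite rmorph_int.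
- exact: monic_map.
by apply/polyOverP => i; rewrite coef_map /= intr_int.
Qed.

Lemma integral_gal (s : {rmorphism L -> L}) (x : L) :
  integralOver ZL x -> integralOver ZL (s x).
Proof.
case=> p mon_p px0; exists p => //.
have -> : map_poly ZL p = map_poly s (map_poly ZL p).
  by rewrite -map_poly_comp; apply: eq_map_poly => c /=; rewrite rmorph_int.
by rewrite fmorph_root.
Qed.

Lemma galois_full : galois 1 {:L}.
Proof.
apply/and3P; split; [exact: sub1v| |exact: normalFieldf].
apply/separableP => y _; apply/negPn/negP => /separablePn_pchar[p].
by rewrite (pchar_lalg L) pchar_num.
Qed.

(** The product is the norm to the rationals, and a rational algebraic integer is an integer. *)
Lemma prod_gal_int (x : L) : integralOver ZL x ->
  iota (\prod_(s : G) s x) \in Num.int.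
Proof.
move=> intx; apply: Cint_rat_Aint; last first.
  by apply/integral_Aint/integral_prod => s _; apply: integral_gal.
have -> : \prod_(s : G) s x = galNorm 1 {:L} x.
  rewrite /galNorm; apply: eq_bigl => s.
  by rewrite gal_kHom ?sub1v // k1AHom.
have /vlineP[k ->] := mem_galNorm galois_full (memvf x).
by rewrite alg_num_field fmorph_rat Crat_rat.
Qed.

Lemma prod_gal_place (x : L) :
  \prod_(s : G) gal_place iota s x = `|iota (\prod_(s : G) s x)|.
Proof.
rewrite rmorph_prod normr_prod (reindex_inj (@invg_inj _)) /=.
by apply: eq_bigr => s _; rewrite /gal_place invgK.
Qed.

(** The norms of [x] and [x^-1] are nonzero integers, so both have absolute value at least 1. *)
Lemma prod_gal_place_unit (x : L) : OL_unit x ->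
  \prod_(s : G) gal_place iota s x = 1.
Proof.
case=> [intx [x0 intxV]].
have ge1 y : integralOver ZL y -> y != 0 -> 1 <= `|iota (\prod_(s : G) s y)|.
  move=> inty y0; apply: norm_intr_ge1; first exact: prod_gal_int.
  by rewrite fmorph_eq0; apply/prodf_neq0 => s _; rewrite fmorph_eq0.
rewrite prod_gal_place; apply/eqP; rewrite eq_le ge1 // andbT.
have := ge1 _ intxV; rewrite invr_eq0 => /(_ x0).
under eq_bigr => s _ do rewrite fmorphV.
rewrite prodfV fmorphV normfV invf_ge1 // normr_gt0 fmorph_eq0.
by apply/prodf_neq0 => s _; rewrite fmorph_eq0.
Qed.

(** Otherwise the norm would be a nonzero integer of absolute value below 1. *)
Lemma integral_small_eq0 (x : L) : integralOver ZL x ->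
  (forall s : G, gal_place iota s x < 1) -> x = 0.
Proof.
move=> intx small; apply/eqP/negPn/negP => x0.
have lt1 : \prod_(s : G) gal_place iota s x < 1.
  rewrite (bigD1 1%g) //=; apply: le_lt_trans (small 1%g).
  rewrite ler_piMr ?normr_ge0 //.
  by apply: prodr_ile1 => s _; rewrite normr_ge0 ltW.
suff ge1 : 1 <= `|iota (\prod_(s : G) s x)|.
  by have := le_lt_trans ge1; rewrite -prod_gal_place => /(_ _ lt1); rewrite ltxx.
apply: norm_intr_ge1; first exact: prod_gal_int.
by rewrite fmorph_eq0; apply/prodf_neq0 => s _; rewrite fmorph_eq0.
Qed.

Lemma gal_placeM (s u : G) (x : L) :
  gal_place iota (s * u)%g x = gal_place iota s ((u^-1)%g x).
Proof. by rewrite /gal_place invMg galM ?memvf. Qed.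

(** Products in [gal_of] apply the left factor first, so right multiplication here is the usual left
    action on places. *)
Lemma same_place_mulr (s t u : G) :
  same_place iota s t -> same_place iota (s * u)%g (t * u)%g.
Proof. by move=> st g; rewrite !gal_placeM. Qed.

Lemma gal_place_unit_gt0 (s : G) (x : L) : x != 0 -> 0 < gal_place iota s x.
Proof. by move=> x0; rewrite normr_gt0 !fmorph_eq0. Qed.

(** The place of [s] is induced by the embedding [iota \o s^-1]. *)
Lemma gal_place_lt1 (b : L) (s : G) : special_Minkowski iota b ->
  ~ same_place iota s 1%g -> gal_place iota s b < 1.
Proof.
move=> [_ bsmall] ns.
pose tau : {rmorphism L -> algC} := iota \o (s^-1)%g.
apply: (bsmall tau) => eq_place; apply: ns => g.
by have /(congr1 (fun h => h g)) := eq_place; rewrite /gal_place invg1 gal_id.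
Qed.

End GaloisPlaces.

(** * Relations between the conjugates of a special unit *)

Section SpecialUnit.

Variables (L : splittingFieldType rat) (iota : {rmorphism L -> algC}).
Variables (N : nat) (psi : 'I_N -> gal_of {:L}) (b : L).
Hypothesis psi_transversal : gal_transversal iota psi.
Hypothesis b_special : special_Minkowski iota b.
Notation G := (gal_of {:L}).
Notation ZL := (intr : int -> L).

Definition place_matrix (m n : 'I_N) : algC := gal_place iota (psi m) (psi n b).

Lemma place_index_exists : exists r : G -> 'I_N,
  forall s, same_place iota s (psi (r s)).
Proof. exact: (fin_all_exists (proj1 psi_transversal)). Qed.

Lemma place_index_unique (r : G -> 'I_N) :
  (forall s, same_place iota s (psi (r s))) ->
  forall s m, same_place iota s (psi m) -> r s = m.
Proof.
move=> rP s m sm; apply: (proj2 psi_transversal) => g.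
by rewrite -rP sm.
Qed.

(** Right translation by [(psi m)^-1 * psi n] carries one fibre into the other; by symmetry all
    fibres have equal size. *)
Lemma card_place_fibre (r : G -> 'I_N) :
  (forall s, same_place iota s (psi (r s))) ->
  forall m n, (#|[pred s | r s == m]| <= #|[pred s | r s == n]|)%N.
Proof.
move=> rP m n; pose u := ((psi m)^-1 * psi n)%g.
rewrite -(card_image (mulIg u)); apply/subset_leq_card/subsetP => _ /imageP[s /eqP rs ->].
apply/eqP/(place_index_unique r) => //.
have /(same_place_mulr _ _ _ _ u) := rP s.
by rewrite rs [in X in same_place _ _ X]/u mulKVg.
Qed.

(** Grouping the product over [G] by places gives a [k]-th power, [k] being the common fibre
    size. *)
Lemma prod_place_unit (x : L) : OL_unit x ->
  \prod_m gal_place iota (psi m) x = 1.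
Proof.
move=> unitx; have [r rP] := place_index_exists.
pose k := #|[pred s | r s == r 1%g]|.
have k_gt0 : (0 < k)%N by apply/card_gt0P; exists 1%g; rewrite inE.
have := prod_gal_place_unit _ iota _ unitx.
rewrite (partition_big r predT) //= (eq_bigr (fun m => gal_place iota (psi m) x ^+ k)).
  rewrite prodrXl => /eqP; rewrite pexpr_eq1 // => [/eqP//|].
  by apply: prodr_ge0 => m _; apply: normr_ge0.
move=> m _; rewrite (eq_bigr (fun=> gal_place iota (psi m) x)) => [|s /eqP <-].
  rewrite prodr_const; congr (_ ^+ _); apply/eqP.
  by rewrite eqn_leq !card_place_fibre.
exact: rP.
Qed.

Let b_neq0 : b != 0. Proof. by case: b_special => -[_ []]. Qed.

Let int_b : integralOver ZL b. Proof. by case: b_special => -[]. Qed.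

Lemma gal_unit (s : G) : OL_unit (s b).
Proof.
case: b_special => -[_ [_ intbV]] _; split; first exact: integral_gal.
by rewrite fmorph_eq0 b_neq0 -fmorphV; split=> //; apply: integral_gal.
Qed.

Lemma place_matrix_gt0 m n : 0 < place_matrix m n.
Proof. by rewrite gal_place_unit_gt0 // fmorph_eq0. Qed.

(** The entry is the value of [b] at the place of [psi m * (psi n)^-1], which is that of [iota] only
    if [m = n]. *)
Lemma place_matrix_lt1 m n : m != n -> place_matrix m n < 1.
Proof.
move=> mn; rewrite /place_matrix -[psi n]invgK -gal_placeM.
apply: gal_place_lt1 => // same1; case/eqP: mn; apply: (proj2 psi_transversal).
by have := same_place_mulr _ _ _ _ (psi n) same1; rewrite mulgKV mul1g.
Qed.

Lemma place_matrix_col1 n : \prod_m place_matrix m n = 1.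
Proof. by rewrite prod_place_unit //; apply: gal_unit. Qed.

Lemma torsion_relation (f : {ffun G -> int}) : is_torsion (Delta psi b f) ->
  forall m, \prod_n place_matrix m n ^ f (psi n) = 1.
Proof.
case=> k [k_gt0 Dk] m.
have -> : \prod_n place_matrix m n ^ f (psi n) =
          gal_place iota (psi m) (Delta psi b f).
  rewrite /gal_place /Delta !rmorph_prod normr_prod; apply: eq_bigr => n _.
  by rewrite !fmorphXz; case: (f _) => l; rewrite /exprz ?normfV normrX.
apply/eqP; rewrite -(pexpr_eq1 k_gt0) ?normr_ge0 //.
by rewrite /gal_place -normrX -!rmorphXn Dk !rmorph1 normr1.
Qed.

Lemma relations_dependent (f g : 'I_N -> int) (n0 : 'I_N) :
  (forall m, \prod_n place_matrix m n ^ f n = 1) ->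
  (forall m, \prod_n place_matrix m n ^ g n = 1) ->
  forall n, f n * g n0 = g n * f n0.
Proof.
move=> relf relg n; apply/eqP; rewrite -subr_eq0; apply/eqP.
(* This combination of the two relations is chosen to vanish at [n0]. *)
apply: (relation_eq0 _ _ _ place_matrix_gt0 place_matrix_lt1 place_matrix_col1
  (fun n => f n * g n0 - g n * f n0) n0); last by rewrite mulrC subrr.
move=> m; have a0 i : place_matrix m i != 0 by rewrite gt_eqF ?place_matrix_gt0.
under eq_bigr => i _ do rewrite expfzDr // -invr_expz -!exprz_exp.
have expP k (F : 'I_N -> algC) : \prod_i F i ^ k = (\prod_i F i) ^ k.
  apply/esym.
  exact: (big_morph (fun x => x ^ k) (fun x y => expfzMl x y _) (exp1rz _ _)).
by rewrite big_split prodfV /= !expP relf relg !exp1rz invr1 mulr1.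
Qed.

Lemma nontrivial_relation : exists i j : {ffun 'I_N -> nat}, i <> j /\
  \prod_n psi n b ^+ i n = \prod_n psi n b ^+ j n.
Proof.
have [r rP] := place_index_exists.
pose w := walk _ _ place_matrix.
pose x k : L := \prod_n psi n b ^+ w k n.
pose A := 1 + \sum_n place_matrix n n.
have A1 : 1 <= A by rewrite ler_wpDr // sumr_ge0 // => n _; apply: normr_ge0.
have aA n : place_matrix n n <= A.
  rewrite /A (bigD1 n) //= addrCA ler_wpDr // addr_ge0 ?ler01 //.
  by rewrite sumr_ge0 // => k _; apply: normr_ge0.
have xA k s : gal_place iota s (x k) <= A.
  rewrite rP; have := walk_bounded _ _ _ place_matrix_gt0 place_matrix_lt1
    place_matrix_col1 (r 1%g) A A1 aA k (r s).
  rewrite /place_value /gal_place /x !rmorph_prod normr_prod => wA.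
  under eq_bigr => n _ do rewrite !rmorphXn normrX.
  exact: wA.
pose M := Num.bound (A + A).
have AA0 : 0 <= A + A by rewrite addr_ge0 // (le_trans ler01).
have M_lt : A + A < M%:R by rewrite archi_boundP.
have M_gt0 : (0 < M)%N by rewrite -(ltr0n algC) (le_lt_trans AA0).
have [C [col colP]] := int_cong_power_color _ _ _ int_b M_gt0.
(* Each exponent is coloured separately, so the two products are congruent factor by factor. *)
have [i [j [ltij]]] := dup_of_nat_seq _ (fun k => [ffun n => col (w k n)]).
move=> /ffunP eq_col; exists (w i), (w j); split.
  have sum_w := sum_walk _ _ _ place_matrix_gt0 place_matrix_col1 (r 1%g).
  by move=> eqw; have := sum_w j; rewrite -/w -eqw sum_w => ij; rewrite ij ltnn in ltij.
have [] := int_cong_prod _ M _ (index_enum 'I_N)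
    (fun n => psi n b ^+ w i n) (fun n => psi n b ^+ w j n).
- by move=> n; apply/integral_exp/integral_gal.
- by move=> n; apply/integral_exp/integral_gal.
- by move=> n; apply: colP; have := eq_col n; rewrite !ffunE.
move=> z intz xz; apply/eqP; rewrite -subr_eq0 xz (integral_small_eq0 _ iota z) ?mulr0 // => s.
(* At every place [M z = x i - x j] has value at most [A + A < M]. *)
rewrite -(ltr_pM2l (_ : 0 < M%:R)) ?ltr0n // mulr1 (le_lt_trans _ M_lt) //.
have -> : M%:R * gal_place iota s z = gal_place iota s (x i - x j).
  by rewrite /x xz /gal_place !rmorphM !rmorph_nat normrM normr_nat.
rewrite /gal_place !rmorphB (le_trans (ler_normB _ _)) // lerD //; exact: xA.
Qed.

End SpecialUnit.

(** * The rank of the group of relations *)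

Lemma ffun_mulrzE (T : finType) (V : zmodType) (f : {ffun T -> V}) (c : int) t :
  (f *~ c) t = f t *~ c.
Proof. by case: c => k; rewrite /intmul ?ffunE ffunMnE. Qed.

Theorem theorem8p1 (L : splittingFieldType rat) (iota : {rmorphism L -> algC})
  (N : nat) (psi : 'I_N -> gal_of {:L}) (b : L) :
  gal_transversal iota psi ->
  special_Minkowski iota b ->
  has_Zrank (fun f : {ffun gal_of {:L} -> int} =>
               ZN iota f /\ is_torsion (Delta psi b f)) 1.
Proof.
move=> psiP bP; have [r rP] := place_index_exists _ _ _ _ psiP.
have r_uniq := place_index_unique _ _ _ _ psiP _ rP.
have r_psi n : r (psi n) = n by apply: r_uniq.
have b0 : b != 0 by case: bP => -[_ []].
split=> [|v vP indep].
  have [i [j [neq_ij eq_ij]]] := nontrivial_relation _ _ _ _ _ psiP bP.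
  (* The exponent differences, spread over [G] through [r] so as to be constant on cosets. *)
  pose h := [ffun s => (i (r s))%:Z - (j (r s))%:Z].
  exists (fun=> h); split=> [_|c].
    split=> [s t st|].
      by rewrite !ffunE (r_uniq s (r t)) // => g; rewrite st rP.
    exists 1%N; split=> //; rewrite expr1 /Delta.
    under eq_bigr => n _.
      rewrite ffunE r_psi expfzDr ?fmorph_eq0 // -invr_expz -!exprnP.
      over.
    rewrite big_split prodfV /= eq_ij divff //.
    by apply/prodf_neq0 => n _; rewrite expf_neq0 ?fmorph_eq0.
  rewrite big_ord1 => /ffunP h0 k; rewrite (ord1 k); apply/eqP/negPn/negP => c0.
  case: neq_ij; apply/ffunP => n; have /eqP := h0 (psi n).
  rewrite ffun_mulrzE !ffunE r_psi mulrzz mulf_eq0 (negPf c0) orbF subr_eq0.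
  by move=> /eqP[].
pose n0 := r 1%g; pose f (k : 'I_2) n := v k (psi n).
have rel k : forall m, \prod_n place_matrix _ iota _ psi b m n ^ f k n = 1.
  by apply: torsion_relation; case: (vP k).
have vE k s : v k s = f k (r s) by apply: (proj1 (vP k)).
have dep := relations_dependent _ _ _ _ _ psiP bP.
(* A relation vanishing at [n0] vanishes everywhere, so [v ord0] would be 0, against
   independence. *)
have f_neq0 : f ord0 n0 != 0.
  apply/eqP => f0; have f_eq0 : forall n, f ord0 n = 0.
    apply: (relation_eq0 _ _ _ (place_matrix_gt0 _ _ _ _ _ bP)
      (place_matrix_lt1 _ _ _ _ _ psiP bP)
      (place_matrix_col1 _ _ _ _ _ psiP bP) _ n0 (rel _)) => //.
  have v0_eq0 : \sum_(k < 2) v k *~ (k == ord0)%:Z = 0.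
    rewrite big_ord_recl big_ord1 /= mulr0z addr0 mulr1z.
    by apply/ffunP => s; rewrite vE f_eq0 ffunE.
  by have := indep _ v0_eq0 ord0.
(* These coefficients are read off from the proportionality [dep]; independence would force
   [f ord0 n0 = 0]. *)
have := indep (fun k => if k == ord0 then f ord_max n0 else - f ord0 n0).
rewrite big_ord_recl big_ord1 /= => /(_ _ ord_max) /= => dep0.
case/eqP: f_neq0; apply: oppr_inj; rewrite oppr0; apply: dep0.
apply/ffunP => s; rewrite !ffunE !ffun_mulrzE !mulrzz !vE.
have -> : lift ord0 ord0 = ord_max :> 'I_2 by apply: val_inj.
by rewrite mulrN dep ?subrr.
Qed.
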